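(* There exist a sequence $M=(M_j)_{j\ge 0}$ of real numbers, increasing with $M_0=1$ and logarithmically convex, such that the local ring $\mathcal{E}_1(M)$ is stable under derivation and non-quasianalytic, and a non-negative element $g$ of $\mathcal{E}_1(M)$ whose square root $\sqrt{g}$ is a germ of $C^\infty$ function at the origin in $\mathbb{R}$ but does not belong to $\mathcal{E}_1(M)$. In particular, setting $\varphi(x,y)=y^2-g(x)$ and $h=\sqrt{g}$, one has that $\varphi$ is a monic polynomial in $y$ with coefficients in $\mathcal{E}_1(M)$ and $h$ is a $C^\infty$ germ with $\varphi(x,h(x))=0$ and $h\notin\mathcal{E}_1(M)$.
   Context: ''Increasing'' is meant in the wide sense; ''logarithmically convex'' means that $M_{j+1}/M_j$ is an increasing (wide sense) function of $j$. $\mathcal{E}_1(M)$ denotes the set of germs $f$ of $C^\infty$ functions at the origin in $\mathbb{R}$ for which there exist a neighborhood $U$ of $0$ in $\mathbb{R}$ and positive constants $C,\sigma$ such that $|f^{(j)}(x)|\le C\sigma^j\, j!\,M_j$ for all integers $j\ge 0$ and all $x\in U$. It is a local ring. It is stable under derivation if $f\in\mathcal{E}_1(M)$ implies $f'\in\mathcal{E}_1(M)$. A $C^\infty$ germ is flat if it vanishes at the origin together with all its derivatives; $\mathcal{E}_1(M)$ is quasianalytic if the only flat germ it contains is $0$, and non-quasianalytic otherwise. *)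

(* Defs.v *)
From Stdlib Require Import Reals Factorial.
From Coquelicot Require Import Coquelicot.
Open Scope R_scope.

(** A germ at the origin of [R] is represented by a function [R -> R], of which
    only the values near [0] matter: two functions define the same germ when
    they are related by [germ_eq].  The lemmas at the end of the file show that
    the notions below only depend on the germ. *)
Definition germ_eq (f g : R -> R) : Prop := locally 0 (fun x => f x = g x).

(** One neighbourhood of [0] serves for all orders of differentiation. *)
Definition smooth_germ (f : R -> R) : Prop :=
  locally 0 (fun x => forall n : nat, ex_derive_n f n x).

Definition calE1 (M : nat -> R) (f : R -> R) : Prop :=
  smooth_germ f /\
  exists C sigma : R, 0 < C /\ 0 < sigma /\
    locally 0 (fun x => forall j : nat,
      Rabs (Derive_n f j x) <= C * sigma ^ j * INR (fact j) * M j).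

(** [Un_growing] is monotonicity in the wide sense. *)
Definition log_convex (M : nat -> R) : Prop :=
  Un_growing (fun j => M (S j) / M j).

Definition stable_under_derivation (A : (R -> R) -> Prop) : Prop :=
  forall f : R -> R, A f -> A (Derive f).

Definition flat_germ (f : R -> R) : Prop := forall j : nat, Derive_n f j 0 = 0.

Definition quasianalytic (A : (R -> R) -> Prop) : Prop :=
  forall f : R -> R, A f -> flat_germ f -> germ_eq f (fun _ => 0).

Definition nonneg_germ (f : R -> R) : Prop := locally 0 (fun x => 0 <= f x).

(** [phi x y] is, as a germ in [x], a monic polynomial in [y] of degree [d]
    with coefficients [a 0, ..., a d] in [A]; [sum_f_R0 _ d] has [d + 1] terms. *)
Definition monic_polynomial_over
    (A : (R -> R) -> Prop) (phi : R -> R -> R) : Prop :=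
  exists (d : nat) (a : nat -> R -> R),
    (forall k : nat, (k <= d)%nat -> A (a k)) /\
    germ_eq (a d) (fun _ => 1) /\
    locally 0 (fun x => forall y : R,
      phi x y = sum_f_R0 (fun k => a k x * y ^ k) d).

Lemma germ_eq_Derive_n (f g : R -> R) :
  germ_eq f g ->
  locally 0 (fun x => forall n : nat, Derive_n f n x = Derive_n g n x).
Proof.
  intros H. generalize (locally_locally _ _ H). apply filter_imp.
  intros x Hx n. now apply Derive_n_ext_loc.
Qed.

Lemma germ_eq_Derive (f g : R -> R) :
  germ_eq f g -> germ_eq (Derive f) (Derive g).
Proof.
  intros H. unfold germ_eq.
  generalize (germ_eq_Derive_n f g H). apply filter_imp.
  intros x Hx. exact (Hx 1%nat).
Qed.

Lemma smooth_germ_ext (f g : R -> R) :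
  germ_eq f g -> smooth_germ f -> smooth_germ g.
Proof.
  intros H Hf. unfold smooth_germ.
  generalize (filter_and _ _ (locally_locally _ _ H) Hf). apply filter_imp.
  intros x [Hx Hfx] n. now apply (ex_derive_n_ext_loc f).
Qed.

Lemma calE1_ext (M : nat -> R) (f g : R -> R) :
  germ_eq f g -> calE1 M f -> calE1 M g.
Proof.
  intros H [Hf [C [s [HC [Hs Hb]]]]].
  split; [now apply (smooth_germ_ext f)|].
  exists C, s. split; [exact HC|]. split; [exact Hs|].
  generalize (filter_and _ _ (germ_eq_Derive_n f g H) Hb). apply filter_imp.
  intros x [Hx Hbx] j. rewrite <- Hx. apply Hbx.
Qed.

Lemma flat_germ_ext (f g : R -> R) : germ_eq f g -> flat_germ f -> flat_germ g.
Proof.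
  intros H Hf j.
  rewrite <- (locally_singleton _ _ (germ_eq_Derive_n f g H) j). apply Hf.
Qed.

(* Main.v *)
Require Import Defs.
From Stdlib Require Import Reals.
From Coquelicot Require Import Coquelicot.
From Stdlib Require Import Lra Lia Factorial.
Open Scope R_scope.

(** Write [t = 1/x].  The witnesses are [M j = (3j)!] and, for [x > 0],
<<
    g(x) = e^(-2t) (1 + t^14 sin(t)^2),   h(x) = e^(-t) sqrt(1 + t^14 sin(t)^2),
>>
    both extended by [0] to [x <= 0].

    Squaring hides the singularities of [h].  Near a zero [1/t] of [sin(1/x)]
    the radicand behaves like [1 + (t^9 (x - 1/t))^2], so [h] has complex branch
    points at distance about [t^-9]: its derivatives of order [J] grow roughly
    like [e^(-t) t^(9J) J!] there, which for [J] comparable with [t] is of the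
    size of [J^(10 J)], far above [J! (3J)!].  On the other hand [g] is [e^(-2t)]
    times a polynomial in [t] and [sin t]; each derivative costs a factor
    [O(j) t^2], and [t^(2j) e^(-2t) <= (2j)!], so the derivatives of [g] are
    bounded by [C s^j (3j)!] ([calE1_flat_ext]).  As [g] is flat and positive
    for [x > 0], it also shows that the ring is not quasianalytic.

    Derivatives are handled formally: expressions in [t], [cos t], [sin t] and
    [1 / sqrt(1 + t^14 sin(t)^2)] are closed under [d/dx] and have polynomial
    growth in [t].  Multiplied by a decaying exponential they extend by [0] to
    smooth functions ([is_derive_flat_ext]), which covers both [g] and [h].

    The lower bound for [h] avoids computing derivatives
    ([root_not_calE1]).  Let [t = J pi] and sample [h] around [1/t] with step
    [t^-7].  At that scale [h] looks like [e^(-t) t^2 |i|], up to an error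
    [K e^(-t)] ([root_near_kink]).  Some [J]-th difference of the sequence [|i|]
    is at least [2^(J-1) / (J-1)] ([exists_large_diff_kink]), whereas the error
    contributes at most [2^J K e^(-t)]; since [t^2] dominates [J], the [J]-th
    difference of [h] is at least [e^(-t) = e^(-pi J)].  If [h] belonged to the
    ring, the same difference would be at most
    [t^(-7J) C s^J J! (3J)! <= C (s t^-3)^J], which is smaller once [J] is
    large. *)

(** * Formal derivatives of expressions in 1/x *)

Definition weight (x : R) : R := 1 + (/ x) ^ 14 * (sin (/ x) * sin (/ x)).

(** Expressions in the variable [/ x]; [RootInv] stands for [1 / sqrt weight].
    Having [1 / sqrt weight] rather than [sqrt weight] as the generator keeps
    the algebra closed under derivation without negative powers. *)
Inductive term : Type :=
| Cst (c : R)
| Pow (n : nat)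
| Cos
| Sin
| RootInv
| Add (a b : term)
| Mul (a b : term).

Fixpoint eval (e : term) (x : R) : R :=
  match e with
  | Cst c => c
  | Pow n => (/ x) ^ n
  | Cos => cos (/ x)
  | Sin => sin (/ x)
  | RootInv => / sqrt (weight x)
  | Add a b => eval a x + eval b x
  | Mul a b => eval a x * eval b x
  end.

Definition Dweight : term :=
  Add (Mul (Cst (-14)) (Mul (Pow 15) (Mul Sin Sin)))
      (Mul (Cst (-2)) (Mul (Pow 16) (Mul Sin Cos))).

Fixpoint deriv (e : term) : term :=
  match e with
  | Cst _ => Cst 0
  | Pow n => Mul (Cst (- INR n)) (Pow (S n))
  | Cos => Mul (Pow 2) Sin
  | Sin => Mul (Cst (-1)) (Mul (Pow 2) Cos)
  | RootInv =>
      Mul (Cst (-1 / 2)) (Mul (Mul RootInv (Mul RootInv RootInv)) Dweight)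
  | Add a b => Add (deriv a) (deriv b)
  | Mul a b => Add (Mul (deriv a) b) (Mul a (deriv b))
  end.

(** [mass e] and [order e] are chosen so that [mass e * (/ x) ^ order e] bounds
    the value of [e] on [(0, 1]].  The order of a trigonometric factor is [1]
    instead of [0], so that it also counts the terms that the Leibniz rule
    produces: see [mass_deriv]. *)
Fixpoint mass (e : term) : R :=
  match e with
  | Cst c => Rabs c
  | Pow _ | Cos | Sin | RootInv => 1
  | Add a b => mass a + mass b
  | Mul a b => mass a * mass b
  end.

Fixpoint order (e : term) : nat :=
  match e with
  | Cst _ | RootInv => 0
  | Pow n => n
  | Cos | Sin => 1
  | Add a b => Nat.max (order a) (order b)
  | Mul a b => order a + order b
  end.

Fixpoint trigonometric (e : term) : Prop :=
  match e with
  | RootInv => False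
  | Add a b | Mul a b => trigonometric a /\ trigonometric b
  | _ => True
  end.

Lemma weight_ge_1 (x : R) : 1 <= weight x.
Proof.
  unfold weight.
  replace ((/ x) ^ 14) with (((/ x) ^ 7) ^ 2) by ring.
  assert (0 <= ((/ x) ^ 7 * sin (/ x)) ^ 2) by apply pow2_ge_0.
  nra.
Qed.

Lemma sqrt_weight_ge_1 (x : R) : 1 <= sqrt (weight x).
Proof.
  rewrite <- sqrt_1. apply sqrt_le_1_alt, weight_ge_1.
Qed.

Lemma is_derive_weight (x : R) :
  0 < x -> is_derive weight x (eval Dweight x).
Proof.
  intros Hx. unfold weight, Dweight. simpl eval.
  auto_derive; [lra|]. simpl. field. lra.
Qed.

Lemma is_derive_eval (e : term) (x : R) :
  0 < x -> is_derive (eval e) x (eval (deriv e) x).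
Proof.
  intros Hx.
  induction e as [c|n| | | |a IHa b IHb|a IHa b IHb]; cbn [eval deriv].
  - apply (is_derive_const (K := R_AbsRing) (V := R_NormedModule)).
  - auto_derive; [lra|]. destruct n as [|n].
    + simpl. ring.
    + rewrite <- pred_Sn. cbn [pow]. field. lra.
  - auto_derive; [lra|]. simpl. field. lra.
  - auto_derive; [lra|]. simpl. field. lra.
  - pose proof (weight_ge_1 x). pose proof (sqrt_weight_ge_1 x).
    evar_last.
    + apply is_derive_inv; [|lra].
      apply is_derive_sqrt; [now apply is_derive_weight|lra].
    + set (D := eval Dweight x). set (s := sqrt (weight x)) in *. simpl.
      field. lra.
  - now apply (is_derive_plus (K := R_AbsRing) (V := R_NormedModule)).
  - evar_last.
    + apply (is_derive_mult (K := R_AbsRing)); [exact IHa|exact IHb|].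
      intros; apply Rmult_comm.
    + reflexivity.
Qed.

Lemma mass_nonneg (e : term) : 0 <= mass e.
Proof.
  induction e; simpl; try lra; [apply Rabs_pos|now apply Rmult_le_pos].
Qed.

Lemma eval_bound (e : term) (x : R) :
  0 < x <= 1 -> Rabs (eval e x) <= mass e * (/ x) ^ order e.
Proof.
  intros Hx.
  assert (H1 : 1 <= / x) by (rewrite <- Rinv_1; apply Rinv_le_contravar; lra).
  induction e as [c|n| | | |a IHa b IHb|a IHa b IHb]; cbn [eval mass order].
  - simpl. lra.
  - rewrite Rabs_pos_eq; [lra|apply pow_le; lra].
  - pose proof (COS_bound (/ x)). simpl. apply Rabs_le. lra.
  - pose proof (SIN_bound (/ x)). simpl. apply Rabs_le. lra.
  - pose proof (sqrt_weight_ge_1 x). simpl.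
    rewrite Rabs_pos_eq by (apply Rlt_le, Rinv_0_lt_compat; lra).
    rewrite Rmult_1_r. apply Rle_trans with (/ 1); [|lra].
    apply Rinv_le_contravar; lra.
  - eapply Rle_trans; [apply Rabs_triang|]. rewrite Rmult_plus_distr_r.
    pose proof (mass_nonneg a). pose proof (mass_nonneg b).
    apply Rplus_le_compat.
    + eapply Rle_trans; [exact IHa|]. apply Rmult_le_compat_l; [assumption|].
      apply Rle_pow; [exact H1|lia].
    + eapply Rle_trans; [exact IHb|]. apply Rmult_le_compat_l; [assumption|].
      apply Rle_pow; [exact H1|lia].
  - rewrite Rabs_mult, pow_add.
    eapply Rle_trans;
      [apply Rmult_le_compat; [apply Rabs_pos|apply Rabs_pos|exact IHa|exact IHb]|].
    right. ring.
Qed.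

Lemma trigonometric_deriv (e : term) :
  trigonometric e -> trigonometric (deriv e).
Proof. induction e; simpl; tauto. Qed.

(** [d/dx = - t^2 d/dt] raises the degree in [t] by at most [2]; the derivative
    of [RootInv] would raise it by a larger amount. *)
Lemma order_deriv (e : term) :
  trigonometric e -> (order (deriv e) <= order e + 2)%nat.
Proof.
  induction e as [c|n| | | |a IHa b IHb|a IHa b IHb]; cbn [order deriv trigonometric];
    intros H; try lia; destruct H as [Ha Hb]; specialize (IHa Ha); specialize (IHb Hb); lia.
Qed.

(** The Leibniz rule on a product of [order e] elementary factors. *)
Lemma mass_deriv (e : term) :
  trigonometric e -> mass (deriv e) <= INR (order e) * mass e.
Proof.
  induction e as [c|n| | | |a IHa b IHb|a IHa b IHb];
    cbn [order deriv trigonometric mass]; intros H.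
  - rewrite Rabs_R0. simpl. lra.
  - rewrite Rabs_Ropp, Rabs_pos_eq by apply pos_INR. lra.
  - simpl. lra.
  - rewrite Rabs_left by lra. simpl. lra.
  - contradiction.
  - destruct H as [Ha Hb]. specialize (IHa Ha). specialize (IHb Hb).
    pose proof (mass_nonneg a). pose proof (mass_nonneg b).
    assert (INR (order a) <= INR (Nat.max (order a) (order b))) by (apply le_INR; lia).
    assert (INR (order b) <= INR (Nat.max (order a) (order b))) by (apply le_INR; lia).
    nra.
  - destruct H as [Ha Hb]. specialize (IHa Ha). specialize (IHb Hb).
    pose proof (mass_nonneg a). pose proof (mass_nonneg b).
    rewrite plus_INR. nra.
Qed.

(** * Flat extension by zero *)

(** The formal derivative on [e], transported through the factor
    [exp (- lam / x)]. *)
Definition dflat (lam : R) (e : term) : term :=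
  Add (Mul (Cst lam) (Mul (Pow 2) e)) (deriv e).

Definition flat (lam : R) (e : term) (x : R) : R := exp (- lam / x) * eval e x.

Definition flat_ext (lam : R) (e : term) (x : R) : R :=
  if Rlt_dec 0 x then flat lam e x else 0.

Lemma flat_ext_pos lam e x : 0 < x -> flat_ext lam e x = flat lam e x.
Proof. intros H. unfold flat_ext. destruct (Rlt_dec 0 x); [easy|lra]. Qed.

Lemma flat_ext_nonpos lam e x : x <= 0 -> flat_ext lam e x = 0.
Proof. intros H. unfold flat_ext. destruct (Rlt_dec 0 x); [lra|easy]. Qed.

Lemma is_derive_flat (lam : R) (e : term) (x : R) :
  0 < x -> is_derive (flat lam e) x (flat lam (dflat lam e) x).
Proof.
  intros Hx. unfold flat. evar_last.
  - apply (is_derive_mult (K := R_AbsRing)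
             (fun x => exp (- lam / x)) (eval e)).
    + auto_derive; [lra|reflexivity].
    + now apply is_derive_eval.
    + intros; apply Rmult_comm.
  - unfold mult, plus, dflat; simpl. unfold Rdiv. field. lra.
Qed.

Lemma pow_le_fact_exp (y : R) (n : nat) : 0 <= y -> y ^ n <= INR (fact n) * exp y.
Proof.
  intros Hy. pose proof (INR_fact_lt_0 n).
  assert (y ^ n / INR (fact n) <= exp y).
  { eapply Rle_trans; [|apply (exp_ge_taylor y n Hy)].
    destruct n as [|n]; [right; reflexivity|]. rewrite tech5.
    assert (0 <= sum_f_R0 (fun k => y ^ k / INR (fact k)) n); [|lra].
    apply cond_pos_sum. intros k. apply Rmult_le_pos; [now apply pow_le|].
    apply Rlt_le, Rinv_0_lt_compat, INR_fact_lt_0. }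
  apply Rmult_le_compat_l with (r := INR (fact n)) in H0; [|lra].
  replace (INR (fact n) * (y ^ n / INR (fact n))) with (y ^ n) in H0 by (field; lra).
  exact H0.
Qed.

(** The factor [x ^ 2], bought by two more powers of [/ x], is what makes the
    extension by [0] differentiable at the origin. *)
Lemma flat_bound (lam : R) (e : term) (x : R) :
  1 <= lam -> 0 < x <= 1 ->
  Rabs (flat lam e x) <= mass e * INR (fact (order e + 2)) * x ^ 2.
Proof.
  intros Hl Hx. unfold flat.
  assert (Hi : 0 < / x) by (apply Rinv_0_lt_compat; lra).
  rewrite Rabs_mult, (Rabs_pos_eq (exp _)) by apply Rlt_le, exp_pos.
  assert (He : exp (- lam / x) <= exp (- / x)).
  { unfold Rdiv. destruct (Req_dec lam 1) as [->|]; [right; f_equal; ring|].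
    apply Rlt_le, exp_increasing. nra. }
  pose proof (eval_bound e x Hx) as Hb.
  pose proof (pow_le_fact_exp (/ x) (order e + 2) (Rlt_le _ _ Hi)) as Hp.
  pose proof (mass_nonneg e).
  assert (Hq : exp (- / x) * (/ x) ^ order e <= INR (fact (order e + 2)) * x ^ 2).
  { rewrite exp_Ropp.
    apply Rmult_le_reg_l with (exp (/ x) * (/ x) ^ 2).
    { apply Rmult_lt_0_compat; [apply exp_pos|now apply pow_lt]. }
    rewrite pow_add in Hp. pose proof (exp_pos (/ x)).
    replace (exp (/ x) * (/ x) ^ 2 * (/ exp (/ x) * (/ x) ^ order e))
      with ((/ x) ^ order e * (/ x) ^ 2) by (field; lra).
    replace (exp (/ x) * (/ x) ^ 2 * (INR (fact (order e + 2)) * x ^ 2))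
      with (INR (fact (order e + 2)) * exp (/ x)) by (field; lra).
    exact Hp. }
  apply Rle_trans with (exp (- / x) * (mass e * (/ x) ^ order e)).
  - apply Rmult_le_compat; try assumption; [apply Rlt_le, exp_pos|apply Rabs_pos].
  - replace (exp (- / x) * (mass e * (/ x) ^ order e))
      with (mass e * (exp (- / x) * (/ x) ^ order e)) by ring.
    rewrite Rmult_assoc. now apply Rmult_le_compat_l.
Qed.

Lemma is_derive_of_quadratic (f : R -> R) (K : R) :
  f 0 = 0 -> locally 0 (fun x => Rabs (f x) <= K * x ^ 2) -> is_derive f 0 0.
Proof.
  intros H0 [d Hd]. apply is_derive_Reals. intros eps Heps.
  assert (HK : 0 < Rabs K + 1) by (pose proof (Rabs_pos K); lra).
  assert (Hm : 0 < Rmin d (eps / (Rabs K + 1))).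
  { apply Rmin_pos; [apply cond_pos|now apply Rdiv_lt_0_compat]. }
  exists (mkposreal _ Hm). intros h Hh Hlt. simpl in Hlt.
  rewrite Rplus_0_l, H0, !Rminus_0_r.
  assert (Hb : Rabs (f h) <= K * h ^ 2).
  { apply Hd. unfold ball; simpl. unfold AbsRing_ball, abs, minus, plus, opp; simpl.
    rewrite Ropp_0, Rplus_0_r. eapply Rlt_le_trans; [exact Hlt|apply Rmin_l]. }
  assert (Hh' : 0 < Rabs h) by now apply Rabs_pos_lt.
  unfold Rdiv. rewrite Rabs_mult, Rabs_inv.
  apply Rle_lt_trans with ((Rabs K + 1) * Rabs h).
  - apply Rmult_le_reg_r with (Rabs h); [exact Hh'|].
    rewrite Rmult_assoc, Rinv_l, Rmult_1_r by lra.
    eapply Rle_trans; [exact Hb|]. rewrite <- pow2_abs.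
    pose proof (Rle_abs K). nra.
  - apply Rlt_le_trans with ((Rabs K + 1) * (eps / (Rabs K + 1))).
    + apply Rmult_lt_compat_l; [exact HK|].
      eapply Rlt_le_trans; [exact Hlt|apply Rmin_r].
    + right. field. lra.
Qed.

(** The derivative is a function of the same kind, so that all orders of
    differentiation follow by iteration. *)
Lemma is_derive_flat_ext (lam : R) (e : term) (x : R) :
  1 <= lam -> is_derive (flat_ext lam e) x (flat_ext lam (dflat lam e) x).
Proof.
  intros Hl. destruct (Rtotal_order x 0) as [Hx|[->|Hx]].
  - rewrite flat_ext_nonpos by lra.
    apply is_derive_ext_loc with (fun _ => 0).
    + apply (locally_interval _ x m_infty 0); simpl; try easy.
      intros y _ Hy. symmetry. apply flat_ext_nonpos. lra.
    + apply (is_derive_const (K := R_AbsRing) (V := R_NormedModule)).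
  - rewrite flat_ext_nonpos by lra.
    apply is_derive_of_quadratic with (mass e * INR (fact (order e + 2))).
    + apply flat_ext_nonpos. lra.
    + apply (locally_interval _ 0 m_infty 1); simpl; [easy|lra|].
      intros y _ Hy. destruct (Rlt_dec 0 y) as [Hy'|Hy'].
      * rewrite flat_ext_pos by easy. apply flat_bound; lra.
      * rewrite flat_ext_nonpos, Rabs_R0 by lra.
        apply Rmult_le_pos; [|apply pow2_ge_0].
        apply Rmult_le_pos; [apply mass_nonneg|apply pos_INR].
  - rewrite flat_ext_pos by easy.
    apply is_derive_ext_loc with (flat lam e).
    + apply (locally_interval _ x 0 p_infty); simpl; try easy.
      intros y Hy _. symmetry. now apply flat_ext_pos.
    + now apply is_derive_flat.
Qed.

Definition dflat_n (lam : R) (n : nat) (e : term) : term := Nat.iter n (dflat lam) e.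

Lemma Derive_n_flat_ext (lam : R) (e : term) (n : nat) (x : R) :
  1 <= lam ->
  Derive_n (flat_ext lam e) n x = flat_ext lam (dflat_n lam n e) x.
Proof.
  intros Hl. revert x. induction n as [|n IH]; intros x; [reflexivity|].
  cbn [Derive_n]. rewrite (Derive_ext _ _ x IH).
  apply is_derive_unique, is_derive_flat_ext, Hl.
Qed.

Lemma smooth_flat_ext (lam : R) (e : term) :
  1 <= lam -> forall n x, ex_derive_n (flat_ext lam e) n x.
Proof.
  intros Hl [|n] x; simpl; [exact I|].
  apply ex_derive_ext with (flat_ext lam (dflat_n lam n e)).
  - intros y. symmetry. now apply Derive_n_flat_ext.
  - eexists. now apply is_derive_flat_ext.
Qed.

(** * The sequence M and the membership of g *)

Lemma trigonometric_dflat_n (lam : R) (e : term) (n : nat) :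
  trigonometric e -> trigonometric (dflat_n lam n e).
Proof.
  intros He. induction n as [|n IH]; [exact He|].
  change (trigonometric (dflat lam (dflat_n lam n e))). simpl.
  repeat split; [exact IH|now apply trigonometric_deriv].
Qed.

Lemma order_dflat_n (lam : R) (e : term) (n : nat) :
  trigonometric e -> (order (dflat_n lam n e) <= order e + 2 * n)%nat.
Proof.
  intros He. induction n as [|n IH]; [simpl; lia|].
  change (dflat_n lam (S n) e) with (dflat lam (dflat_n lam n e)).
  pose proof (order_deriv _ (trigonometric_dflat_n lam e n He)).
  cbn [dflat order]. lia.
Qed.

Lemma mass_dflat_n (m : nat) (e : term) (n : nat) :
  trigonometric e ->
  mass (dflat_n (INR m) n e) <= INR (order e + m + 2 * n) ^ n * mass e.
Proof.
  intros He. induction n as [|n IH]; [simpl; lra|].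
  change (dflat_n (INR m) (S n) e) with (dflat (INR m) (dflat_n (INR m) n e)).
  pose proof (mass_deriv _ (trigonometric_dflat_n (INR m) e n He)) as Hd.
  pose proof (order_dflat_n (INR m) e n He) as Ho. apply le_INR in Ho.
  cbn [dflat mass]. rewrite (Rabs_pos_eq (INR m)) by apply pos_INR.
  set (q := mass (dflat_n (INR m) n e)) in *.
  assert (Hq : 0 <= q) by apply mass_nonneg.
  pose proof (mass_nonneg e) as Hm.
  assert (H1 : INR (order e + m + 2 * n) <= INR (order e + m + 2 * S n))
    by (apply le_INR; lia).
  pose proof (pos_INR (order e + m + 2 * n)).
  apply Rle_trans with (INR (order e + m + 2 * n) * q).
  { rewrite !plus_INR in *. nra. }
  cbn [pow]. rewrite Rmult_assoc.
  apply Rmult_le_compat; try assumption.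
  eapply Rle_trans; [exact IH|].
  apply Rmult_le_compat_r; [exact Hm|]. now apply pow_incr.
Qed.

Lemma pow_mult_fact_le (p j : nat) : INR p ^ j * INR (fact p) <= INR (fact (p + j)).
Proof.
  induction j as [|j IH]; [simpl; rewrite Nat.add_0_r; lra|].
  rewrite Nat.add_succ_r. cbn [pow].
  change (fact (S (p + j))) with (S (p + j) * fact (p + j))%nat.
  rewrite mult_INR, Rmult_assoc.
  apply Rmult_le_compat; [apply pos_INR| |apply le_INR; lia|exact IH].
  apply Rmult_le_pos; [apply pow_le, pos_INR|apply pos_INR].
Qed.

Lemma fact_plus_le (p q : nat) :
  INR (fact (p + q)) <= 2 ^ (p + q) * (INR (fact p) * INR (fact q)).
Proof.
  remember (p + q)%nat as n eqn:E. revert p q E.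
  induction n as [|n IH]; intros p q E.
  - replace p with 0%nat by lia. replace q with 0%nat by lia. simpl. lra.
  - assert (Hpow : 1 <= 2 ^ S n) by (apply pow_R1_Rle; lra).
    destruct p as [|p].
    { simpl in E. rewrite <- E. replace (INR (fact 0)) with 1 by reflexivity.
      pose proof (pos_INR (fact (S n))). nra. }
    destruct q as [|q].
    { rewrite Nat.add_0_r in E. rewrite <- E.
      replace (INR (fact 0)) with 1 by reflexivity.
      pose proof (pos_INR (fact (S n))). nra. }
    pose proof (IH p (S q) ltac:(lia)) as H1.
    pose proof (IH (S p) q ltac:(lia)) as H2.
    change (fact (S n)) with (S n * fact n)%nat. rewrite mult_INR.
    replace (INR (S n)) with (INR (S p) + INR (S q)) by (rewrite <- plus_INR; f_equal; lia).
    change (fact (S p)) with (S p * fact p)%nat in *.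
    change (fact (S q)) with (S q * fact q)%nat in *.
    rewrite mult_INR in *. rewrite mult_INR in *.
    apply Rmult_le_compat_l with (r := INR (S p)) in H1; [|apply pos_INR].
    apply Rmult_le_compat_l with (r := INR (S q)) in H2; [|apply pos_INR].
    cbn [pow]. lra.
Qed.

(** With the factor [j!] of the definition of the ring, the bounds on
    derivatives are [C s^j j! (3j)!]. *)
Definition gevrey (j : nat) : R := INR (fact (3 * j)).

Lemma gevrey_pos (j : nat) : 0 < gevrey j.
Proof. apply INR_fact_lt_0. Qed.

Lemma gevrey_S (j : nat) :
  gevrey (S j) =
  (3 * INR j + 3) * (3 * INR j + 2) * (3 * INR j + 1) * gevrey j.
Proof.
  unfold gevrey. replace (3 * S j)%nat with (S (S (S (3 * j)))) by lia.
  change (fact (S (S (S (3 * j)))))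
    with (S (S (S (3 * j))) * (S (S (3 * j)) * (S (3 * j) * fact (3 * j))))%nat.
  rewrite !mult_INR, !S_INR, mult_INR. simpl (INR 3). ring.
Qed.

Lemma gevrey_growing : Un_growing gevrey.
Proof. intros j. apply le_INR, fact_le. lia. Qed.

Lemma gevrey_log_convex : log_convex gevrey.
Proof.
  assert (H : forall j, gevrey (S j) / gevrey j =
    (3 * INR j + 3) * (3 * INR j + 2) * (3 * INR j + 1)).
  { intros j. rewrite gevrey_S. field. pose proof (gevrey_pos j). lra. }
  intros j. rewrite !H, S_INR. pose proof (pos_INR j).
  repeat apply Rmult_le_compat; try nra.
Qed.

(** The quotient [gevrey (S j) / gevrey j] is polynomial in [j], hence absorbed
    by a larger geometric factor. *)
Lemma gevrey_stable : stable_under_derivation (calE1 gevrey).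
Proof.
  assert (Hn : forall f n x, Derive_n (Derive f) n x = Derive_n f (S n) x).
  { intros f n x. rewrite <- Nat.add_1_r. apply (Derive_n_comp f n 1). }
  intros f [Hf [C [s [HC [Hs Hb]]]]]. split.
  - unfold smooth_germ. generalize (locally_locally _ _ Hf). apply filter_imp.
    intros x Hx [|n]; [exact I|].
    apply ex_derive_ext with (Derive_n f (S n)).
    + intros t. symmetry. apply Hn.
    + exact (locally_singleton _ _ Hx (S (S n))).
  - exists (C * s * 27), (16 * s). repeat split; try nra.
    generalize Hb. apply filter_imp. intros x Hx j. rewrite Hn.
    eapply Rle_trans; [apply Hx|]. rewrite gevrey_S.
    change (fact (S j)) with (S j * fact j)%nat.
    rewrite mult_INR, S_INR, Rpow_mult_distr. cbn [pow].
    (* (j + 1)^4 <= 16^j absorbs the polynomial factors. *)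
    assert (H2 : INR j + 1 <= 2 ^ j).
    { rewrite <- S_INR. clear. induction j as [|j IH]; [simpl; lra|].
      rewrite S_INR. cbn [pow]. pose proof (pos_INR j). rewrite S_INR in *. lra. }
    pose proof (pos_INR j).
    assert (Hp : (INR j + 1) * ((3 * INR j + 3) * (3 * INR j + 2) * (3 * INR j + 1))
      <= 27 * 16 ^ j).
    { replace 16 with (2 ^ 4) by ring. rewrite <- pow_mult, Nat.mul_comm, pow_mult.
      apply Rle_trans with (27 * (INR j + 1) ^ 4).
      - nra.
      - apply Rmult_le_compat_l; [lra|]. apply pow_incr. lra. }
    assert (0 <= C * s * s ^ j * INR (fact j) * gevrey j).
    { pose proof (gevrey_pos j). pose proof (INR_fact_lt_0 j). pose proof (pow_lt s j Hs).
      repeat apply Rmult_le_pos; lra. }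
    nra.
Qed.

(** The [j]-th derivative is [exp (- 2 / x)] times an expression of order at
    most [order e + 2 j] and mass [O(j)^j]; the exponential turns the order into
    a factorial, and the mass merges with it by [pow_mult_fact_le]. *)
Lemma calE1_flat_ext (e : term) :
  trigonometric e -> calE1 gevrey (flat_ext 2 e).
Proof.
  intros He. split.
  - unfold smooth_germ. apply filter_forall. intros x n. apply smooth_flat_ext. lra.
  - (* The 2 is lam in the bound on the mass, and comes from the factor x ^ 2 of
       flat_bound in the bound on the order. *)
    set (b := (order e + 2)%nat).
    exists (mass e * (2 ^ b * INR (fact b)) + 1), 8.
    pose proof (mass_nonneg e) as Hm. pose proof (INR_fact_lt_0 b) as Hfb.
    pose proof (pow_lt 2 b ltac:(lra)) as H2b.
    split; [assert (0 <= mass e * (2 ^ b * INR (fact b))) by (apply Rmult_le_pos; nra); lra|].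
    split; [lra|].
    apply (locally_interval _ 0 m_infty 1); simpl; [easy|lra|].
    intros x _ Hx j. rewrite Derive_n_flat_ext by lra.
    pose proof (gevrey_pos j) as Hg. pose proof (pow_lt 8 j ltac:(lra)) as H8.
    assert (Hf1 : 1 <= INR (fact j)).
    { apply (le_INR 1). pose proof (lt_O_fact j). lia. }
    assert (Hrhs : mass e * INR (fact (b + 3 * j)) <=
      (mass e * (2 ^ b * INR (fact b)) + 1) * 8 ^ j * INR (fact j) * gevrey j).
    { pose proof (fact_plus_le b (3 * j)) as H. rewrite pow_add, pow_mult in H.
      replace (2 ^ 3) with 8 in H by ring. fold (gevrey j) in H.
      apply Rmult_le_compat_l with (r := mass e) in H; [|exact Hm].
      eapply Rle_trans; [exact H|].
      set (B := mass e * (2 ^ b * INR (fact b))).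
      assert (0 <= B) by (apply Rmult_le_pos; nra).
      replace (mass e * (2 ^ b * 8 ^ j * (INR (fact b) * gevrey j)))
        with (B * (8 ^ j * gevrey j)) by (unfold B; ring).
      assert (0 < 8 ^ j * gevrey j) by now apply Rmult_lt_0_compat.
      apply Rle_trans with ((B + 1) * (8 ^ j * gevrey j)); [nra|].
      replace ((B + 1) * 8 ^ j * INR (fact j) * gevrey j)
        with ((B + 1) * (8 ^ j * gevrey j) * INR (fact j)) by ring.
      assert (0 < (B + 1) * (8 ^ j * gevrey j)) by (apply Rmult_lt_0_compat; lra).
      nra. }
    eapply Rle_trans; [|exact Hrhs].
    destruct (Rlt_dec 0 x) as [Hx'|Hx'].
    + rewrite flat_ext_pos by easy.
      eapply Rle_trans; [apply flat_bound; lra|].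
      set (d := dflat_n 2 j e).
      assert (Hd1 : mass d <= INR (b + 2 * j) ^ j * mass e).
      { eapply Rle_trans; [exact (mass_dflat_n 2 e j He)|].
        apply Rmult_le_compat_r; [exact Hm|]. apply pow_incr.
        split; [apply pos_INR|apply le_INR; unfold b; lia]. }
      assert (Hd2 : INR (fact (order d + 2)) <= INR (fact (b + 2 * j))).
      { apply le_INR, fact_le. pose proof (order_dflat_n 2 e j He).
        unfold b, d. lia. }
      pose proof (pow_mult_fact_le (b + 2 * j) j) as Hp.
      replace (b + 2 * j + j)%nat with (b + 3 * j)%nat in Hp by lia.
      assert (x ^ 2 <= 1) by nra. pose proof (pow2_ge_0 x).
      pose proof (mass_nonneg d). pose proof (INR_fact_lt_0 (order d + 2)).
      assert (mass d * INR (fact (order d + 2)) <=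
        INR (b + 2 * j) ^ j * mass e * INR (fact (b + 2 * j))).
      { apply Rmult_le_compat; lra. }
      assert (0 <= mass d * INR (fact (order d + 2))) by (apply Rmult_le_pos; lra).
      apply Rmult_le_compat_l with (r := mass e) in Hp; [|exact Hm].
      nra.
    + rewrite flat_ext_nonpos, Rabs_R0 by lra.
      apply Rmult_le_pos; [exact Hm|apply pos_INR].
Qed.

(** * Iterated differences *)

Fixpoint diff (n : nat) (u : nat -> R) (i : nat) : R :=
  match n with
  | O => u i
  | S n => diff n u (S i) - diff n u i
  end.

Lemma diff_S_inner (n : nat) (u : nat -> R) (i : nat) :
  diff (S n) u i = diff n (fun k => u (S k) - u k) i.
Proof.
  revert i. induction n as [|n IH]; intros i; [reflexivity|].
  change (diff (S (S n)) u i) with (diff (S n) u (S i) - diff (S n) u i).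
  rewrite !IH. reflexivity.
Qed.

Lemma diff_shift (n : nat) (u : nat -> R) (i : nat) :
  diff n (fun k => u (S k)) i = diff n u (S i).
Proof.
  revert i. induction n as [|n IH]; intros i; simpl; [reflexivity|].
  now rewrite !IH.
Qed.

Lemma diff_ext (n : nat) (u v : nat -> R) (i : nat) :
  (forall k, (i <= k <= i + n)%nat -> u k = v k) -> diff n u i = diff n v i.
Proof.
  revert i. induction n as [|n IH]; intros i H; simpl; [apply H; lia|].
  rewrite (IH (S i)), (IH i); [reflexivity| |]; intros k Hk; apply H; lia.
Qed.

Lemma diff_scal (n : nat) (c : R) (u : nat -> R) (i : nat) :
  diff n (fun k => c * u k) i = c * diff n u i.
Proof.
  revert i. induction n as [|n IH]; intros i; simpl; [reflexivity|].
  rewrite !IH. ring.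
Qed.

Lemma diff_minus (n : nat) (u v : nat -> R) (i : nat) :
  diff n (fun k => u k - v k) i = diff n u i - diff n v i.
Proof.
  revert i. induction n as [|n IH]; intros i; simpl; [reflexivity|].
  rewrite !IH. ring.
Qed.

Lemma diff_sum (n N : nat) (u : nat -> nat -> R) (i : nat) :
  diff n (fun k => sum_f_R0 (fun p => u p k) N) i =
  sum_f_R0 (fun p => diff n (u p) i) N.
Proof.
  revert i. induction n as [|n IH]; intros i; simpl; [reflexivity|].
  now rewrite !IH, <- minus_sum.
Qed.

Lemma diff_bound (n : nat) (u : nat -> R) (E : R) (i : nat) :
  (forall k, (i <= k <= i + n)%nat -> Rabs (u k) <= E) ->
  Rabs (diff n u i) <= 2 ^ n * E.
Proof.
  revert i. induction n as [|n IH]; intros i H; simpl.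
  - rewrite Rmult_1_l. apply H. lia.
  - assert (H1 : Rabs (diff n u (S i)) <= 2 ^ n * E) by (apply IH; intros; apply H; lia).
    assert (H2 : Rabs (diff n u i) <= 2 ^ n * E) by (apply IH; intros; apply H; lia).
    unfold Rminus. eapply Rle_trans; [apply Rabs_triang|]. rewrite Rabs_Ropp. lra.
Qed.

Lemma diff_alternating (n i : nat) :
  diff n (fun k => (-1) ^ k) i = (-2) ^ n * (-1) ^ i.
Proof.
  revert i. induction n as [|n IH]; intros i; simpl; [ring|].
  rewrite !IH. simpl. ring.
Qed.

Definition spike (p k : nat) : R := if Nat.eq_dec k p then 1 else 0.

Lemma sum_spike (c : nat -> R) (N k : nat) :
  (k <= N)%nat -> sum_f_R0 (fun p => c p * spike p k) N = c k.
Proof.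
  intros Hk. induction N as [|N IH].
  - replace k with 0%nat by lia. simpl. unfold spike. simpl. ring.
  - rewrite tech5. unfold spike at 2.
    destruct (Nat.eq_dec k (S N)) as [->|Hne].
    + rewrite (sum_eq _ (fun _ => 0)).
      * rewrite sum_cte. ring.
      * intros p Hp. unfold spike. destruct (Nat.eq_dec (S N) p); [lia|ring].
    + rewrite IH by lia. ring.
Qed.

(** The alternating sequence has [n]-th difference [(-2)^n] and is a combination
    of the spikes at [0, ..., n] with coefficients [1] or [-1]; one of these
    [n + 1] spikes must contribute at least the average. *)
Lemma exists_large_diff_spike (n : nat) :
  exists p, (p <= n)%nat /\ 2 ^ n <= INR (S n) * Rabs (diff n (spike p) 0).
Proof.
  assert (Hsum : 2 ^ n <= sum_f_R0 (fun p => Rabs (diff n (spike p) 0)) n).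
  { assert (H : diff n (fun k => (-1) ^ k) 0 =
                sum_f_R0 (fun p => (-1) ^ p * diff n (spike p) 0) n).
    { rewrite (diff_ext n _ (fun k => sum_f_R0 (fun p => (-1) ^ p * spike p k) n)).
      - rewrite (diff_sum n n (fun p k => (-1) ^ p * spike p k)).
        apply sum_eq. intros p _. apply diff_scal.
      - intros k Hk. symmetry. apply (sum_spike (fun p => (-1) ^ p)). lia. }
    rewrite diff_alternating in H.
    replace (2 ^ n) with (Rabs ((-2) ^ n * (-1) ^ 0)).
    - rewrite H. eapply Rle_trans; [apply Rsum_abs|]. right. apply sum_eq.
      intros p _. rewrite Rabs_mult, pow_1_abs. ring.
    - rewrite Rmult_1_r, <- RPow_abs. f_equal. rewrite Rabs_left; lra. }
  (* Either one of the first N + 1 spikes is large, or their total stays below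
     N + 1 times the average; at N = n the second case contradicts Hsum. *)
  assert (Hpigeon : forall N, (exists p, (p <= N)%nat /\
            2 ^ n <= INR (S n) * Rabs (diff n (spike p) 0)) \/
          INR (S n) * sum_f_R0 (fun p => Rabs (diff n (spike p) 0)) N < INR (S N) * 2 ^ n).
  { induction N as [|N IH].
    - destruct (Rle_lt_dec (2 ^ n) (INR (S n) * Rabs (diff n (spike 0) 0))) as [H|H].
      + left. now exists 0%nat.
      + right. simpl sum_f_R0. replace (INR 1) with 1 by reflexivity. lra.
    - destruct IH as [[p [Hp H]]|IH]; [left; exists p; split; [lia|exact H]|].
      destruct (Rle_lt_dec (2 ^ n) (INR (S n) * Rabs (diff n (spike (S N)) 0))) as [H|H].
      + left. now exists (S N).
      + right. rewrite tech5, (S_INR (S N)). lra. }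
  destruct (Hpigeon n) as [H|H]; [exact H|].
  pose proof (lt_0_INR (S n) ltac:(lia)). nra.
Qed.

(** The kink is at [S p] so that its second difference is twice [spike p]. *)
Definition kink (p k : nat) : R := Rabs (INR k - INR (S p)).

Lemma diff_kink (n p : nat) : diff (S (S n)) (kink p) 0 = 2 * diff n (spike p) 0.
Proof.
  rewrite !diff_S_inner, <- diff_scal. apply diff_ext. intros k _.
  unfold kink, spike. rewrite !S_INR.
  destruct (Nat.eq_dec k p) as [->|Hne].
  - replace (INR p + 1 + 1 - (INR p + 1)) with 1 by ring.
    replace (INR p + 1 - (INR p + 1)) with 0 by ring.
    replace (INR p - (INR p + 1)) with (-1) by ring.
    rewrite Rabs_R0, Rabs_R1, Rabs_left by lra. ring.
  - destruct (Nat.lt_ge_cases k p) as [Hlt|Hge].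
    + assert (INR k + 1 <= INR p) by (rewrite <- S_INR; apply le_INR; lia).
      rewrite !Rabs_left1 by lra. ring.
    + assert (INR p + 1 <= INR k) by (rewrite <- S_INR; apply le_INR; lia).
      rewrite !Rabs_pos_eq by lra. ring.
Qed.

Lemma exists_large_diff_kink (n : nat) :
  exists p, (p <= n)%nat /\
    2 * 2 ^ n <= INR (S n) * Rabs (diff (S (S n)) (kink p) 0).
Proof.
  destruct (exists_large_diff_spike n) as [p [Hp H]]. exists p. split; [exact Hp|].
  rewrite diff_kink, Rabs_mult, (Rabs_pos_eq 2) by lra. lra.
Qed.

Lemma is_derive_diff (f f' : R -> R) (s : R) (n i : nat) (x : R) :
  (forall y, is_derive f y (f' y)) ->
  is_derive (fun y => diff n (fun k => f (y + INR k * s)) i) x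
            (diff n (fun k => f' (x + INR k * s)) i).
Proof.
  intros Hf. revert i. induction n as [|n IH]; intros i; simpl.
  - evar_last.
    + apply (is_derive_comp f (fun y => y + INR i * s)); [apply Hf|].
      auto_derive; [exact I|reflexivity].
    + unfold scal; simpl. unfold mult; simpl. ring.
  - now apply (is_derive_minus (K := R_AbsRing) (V := R_NormedModule)).
Qed.

(** The difference of order [n] of [F j] has for derivative the difference of
    order [n] of [F (S j)]; each use of the mean value theorem thus trades one
    difference for a factor [s] and one derivative. *)
Lemma diff_le_derivative (F : nat -> R -> R) (s B : R) (n j : nat) (x : R) :
  0 < s ->
  (forall k y, is_derive (F k) y (F (S k) y)) ->
  (forall y, x <= y <= x + INR n * s -> Rabs (F (j + n)%nat y) <= B) ->
  Rabs (diff n (fun k => F j (x + INR k * s)) 0) <= s ^ n * B.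
Proof.
  intros Hs HF. revert j x. induction n as [|n IH]; intros j x HB.
  - simpl. replace (x + 0 * s) with x by ring. rewrite Rmult_1_l.
    rewrite <- (Nat.add_0_r j). apply HB. simpl. lra.
  - cbn [diff]. rewrite <- diff_shift.
    set (G := fun y => diff n (fun k => F j (y + INR k * s)) 0).
    set (G' := fun y => diff n (fun k => F (S j) (y + INR k * s)) 0).
    assert (HG : forall y, is_derive G y (G' y)).
    { intros y. now apply is_derive_diff. }
    replace (diff n (fun k => F j (x + INR (S k) * s)) 0) with (G (x + s)).
    2:{ apply diff_ext. intros k _. f_equal. rewrite S_INR. ring. }
    change (Rabs (G (x + s) - G x) <= s ^ S n * B).
    destruct (MVT_gen G x (x + s) G') as [c [Hc Heq]].
    + intros y _. apply HG.
    + intros y _. apply continuity_pt_filterlim.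
      apply (ex_derive_continuous G y). exists (G' y). apply HG.
    + rewrite Heq. replace (x + s - x) with s by ring.
      rewrite Rmin_left, Rmax_right in Hc by lra.
      rewrite Rabs_mult, (Rabs_pos_eq s) by lra. cbn [pow].
      assert (Rabs (G' c) <= s ^ n * B).
      { apply IH. intros y Hy. rewrite Nat.add_succ_comm. apply HB.
        rewrite S_INR. lra. }
      pose proof (Rabs_pos (G' c)). nra.
Qed.

(** * Lower bound for the square root *)

Definition weight_term : term := Add (Cst 1) (Mul (Pow 14) (Mul Sin Sin)).

Definition root_term : term := Mul weight_term RootInv.

(** The signed square root of the oscillating part of the weight: its absolute
    value is the shape that the square root follows away from its zeros. *)
Definition slope_term : term := Mul (Pow 7) Sin.

Lemma eval_root_term (x : R) : eval root_term x = sqrt (weight x).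
Proof.
  pose proof (weight_ge_1 x). pose proof (sqrt_weight_ge_1 x).
  change (weight x * / sqrt (weight x) = sqrt (weight x)).
  rewrite <- (sqrt_sqrt (weight x)) at 1 by lra. field. lra.
Qed.

Lemma flat_ext_weight_nonneg (x : R) : 0 <= flat_ext 2 weight_term x.
Proof.
  unfold flat_ext. destruct (Rlt_dec 0 x) as [Hx|Hx]; [|lra].
  pose proof (weight_ge_1 x). pose proof (exp_pos (- (2) / x)).
  change (0 <= exp (- (2) / x) * weight x). nra.
Qed.

Lemma sqrt_flat_ext_weight (x : R) :
  sqrt (flat_ext 2 weight_term x) = flat_ext 1 root_term x.
Proof.
  unfold flat_ext. destruct (Rlt_dec 0 x) as [Hx|Hx]; [|apply sqrt_0].
  unfold flat. rewrite eval_root_term.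
  change (eval weight_term x) with (weight x).
  replace (- (2) / x) with (- (1) / x + - (1) / x) by (field; lra).
  rewrite exp_plus, sqrt_mult_alt.
  - rewrite sqrt_square; [reflexivity|apply Rlt_le, exp_pos].
  - pose proof (exp_pos (- (1) / x)). nra.
Qed.

(** [sqrt (1 + b^2)] lies between [b] and [1 + b] for [b >= 0]. *)
Lemma root_near_abs_slope (x : R) :
  0 < x ->
  Rabs (flat_ext 1 root_term x - Rabs (flat 1 slope_term x)) <= exp (- / x).
Proof.
  intros Hx. rewrite flat_ext_pos by easy. unfold flat.
  rewrite eval_root_term.
  replace (- (1) / x) with (- / x) by (field; lra).
  pose proof (exp_pos (- / x)) as He.
  rewrite Rabs_mult, (Rabs_pos_eq (exp _)) by lra.
  rewrite <- Rmult_minus_distr_l, Rabs_mult, (Rabs_pos_eq (exp _)) by lra.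
  set (a := eval slope_term x).
  assert (Ha : weight x = 1 + Rabs a ^ 2).
  { rewrite pow2_abs. unfold weight, a. simpl. ring. }
  pose proof (Rabs_pos a) as Hp. set (b := Rabs a) in *.
  assert (H1 : b <= sqrt (weight x)).
  { rewrite <- (sqrt_pow2 b) by easy. apply sqrt_le_1_alt. lra. }
  assert (H2 : sqrt (weight x) <= 1 + b).
  { rewrite <- (sqrt_pow2 (1 + b)) by lra. apply sqrt_le_1_alt. nra. }
  rewrite Rabs_pos_eq by lra. nra.
Qed.

(** On this scale the functions of [1/y] that occur below change by bounded
    factors only: [1/y >= t - 1] costs the factor [e <= 3]. *)
Lemma close_point (t y : R) :
  3 <= t -> Rabs (y - / t) <= (/ t) ^ 6 ->
  0 < y <= 1 /\ / y <= 2 * t /\ exp (- / y) <= 3 * exp (- t) /\ y <= 2 * / t.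
Proof.
  intros Ht Hy. set (w := / t) in *.
  assert (Hw : 0 < w) by (apply Rinv_0_lt_compat; lra).
  assert (Htw : t * w = 1) by (apply Rinv_r; lra).
  assert (Hw3 : w <= 1 / 3) by nra.
  assert (H2 : 0 < w ^ 2 <= w / 3) by nra.
  assert (H4 : 0 < w ^ 4 <= 1 / 9) by (replace (w ^ 4) with (w ^ 2 * w ^ 2) by ring; nra).
  assert (H5 : 0 < w ^ 5 <= w / 9) by (replace (w ^ 5) with (w * w ^ 4) by ring; nra).
  assert (H6 : 0 < w ^ 6 <= w / 27) by (replace (w ^ 6) with (w * w ^ 5) by ring; nra).
  apply Rabs_le_between in Hy.
  assert (Hy0 : 0 < y) by lra.
  assert (Hyi : y * / y = 1) by (apply Rinv_r; lra).
  assert (0 < / y) by now apply Rinv_0_lt_compat.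
  repeat split; try lra.
  - apply Rmult_le_reg_l with y; [easy|]. rewrite Hyi. nra.
  - assert (Hm : t - 1 <= / y).
    { apply Rmult_le_reg_l with y; [easy|]. rewrite Hyi.
      assert ((w + w ^ 6) * (t - 1) = 1 - w + w ^ 5 - w ^ 6).
      { replace (w ^ 6) with (w ^ 5 * w) by ring.
        replace ((w + w ^ 5 * w) * (t - 1))
          with ((t * w) * (1 + w ^ 5) - w - w ^ 5 * w) by ring.
        rewrite Htw. ring. }
      nra. }
    apply Rle_trans with (exp (1 + - t)).
    + destruct (Req_dec (- / y) (1 + - t)) as [->|]; [lra|].
      apply Rlt_le, exp_increasing. lra.
    + rewrite exp_plus. pose proof exp_le_3. pose proof (exp_pos (- t)). nra.
Qed.

(** First order Taylor expansion at a zero [/ t] of [slope_term], where the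
    derivative is [- e^(-t) t^9 cos t].  The second derivative is [e^(-t)] times
    an expression of order [8 + 2 * 2 = 12]. *)
Lemma slope_almost_linear :
  exists K, 0 < K /\ forall t x : R,
    3 <= t -> sin t = 0 -> Rabs (x - / t) <= (/ t) ^ 6 ->
    Rabs (Rabs (flat 1 slope_term x) - exp (- t) * t ^ 9 * Rabs (x - / t))
      <= K * (exp (- t) * t ^ 12 * (x - / t) ^ 2).
Proof.
  set (d1 := dflat 1 slope_term). set (d2 := dflat 1 d1).
  exists (mass d2 * 2 ^ 12 * 3 + 1). split.
  { pose proof (mass_nonneg d2).
    assert (0 <= mass d2 * 2 ^ 12 * 3) by (apply Rmult_le_pos; nra). lra. }
  intros t x Ht Hsin Hx.
  set (w := / t) in *. set (q := flat 1 slope_term).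
  assert (Hw : 0 < w) by (apply Rinv_0_lt_compat; lra).
  assert (Hw6 : 0 <= w ^ 6) by (apply pow_le; lra).
  assert (Hwi : / w = t) by (unfold w; apply Rinv_inv).
  assert (He : - (1) / w = - t) by (rewrite <- Hwi; field; lra).
  set (B := mass d2 * 2 ^ 12 * 3 * (exp (- t) * t ^ 12)).
  assert (HB : forall y, Rabs (y - w) <= w ^ 6 -> Rabs (flat 1 d2 y) <= B).
  { intros y Hy. destruct (close_point t y Ht Hy) as (Hy1 & Hy2 & Hy3 & _).
    unfold flat. rewrite Rabs_mult, Rabs_pos_eq by apply Rlt_le, exp_pos.
    replace (- (1) / y) with (- / y) by (field; lra).
    pose proof (eval_bound d2 y Hy1) as Hb.
    assert (Ho : (order d2 <= 12)%nat).
    { apply (order_dflat_n 1 slope_term 2). simpl. tauto. }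
    assert (H1 : 1 <= / y) by (rewrite <- Rinv_1; apply Rinv_le_contravar; lra).
    assert (Hp : (/ y) ^ order d2 <= 2 ^ 12 * t ^ 12).
    { rewrite <- Rpow_mult_distr. apply Rle_trans with ((/ y) ^ 12).
      - now apply Rle_pow.
      - apply pow_incr. lra. }
    pose proof (mass_nonneg d2).
    apply Rle_trans with (3 * exp (- t) * (mass d2 * (2 ^ 12 * t ^ 12))).
    - apply Rmult_le_compat; [apply Rlt_le, exp_pos|apply Rabs_pos|exact Hy3|].
      eapply Rle_trans; [exact Hb|]. now apply Rmult_le_compat_l.
    - right. unfold B. ring. }
  assert (Hq : forall y, Rabs (y - w) <= w ^ 6 -> is_derive q y (flat 1 d1 y)).
  { intros y Hy. apply is_derive_flat. apply (close_point t y Ht Hy). }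
  assert (Hq1 : forall y, Rabs (y - w) <= w ^ 6 ->
            Rabs (flat 1 d1 y - flat 1 d1 w) <= B * Rabs (y - w)).
  { intros y Hy. apply (bounded_variation (flat 1 d1) (flat 1 d2)).
    intros u Hu. assert (Rabs (u - w) <= w ^ 6) by lra. split.
    - apply is_derive_flat. now apply (close_point t u Ht).
    - now apply HB. }
  assert (HB0 : 0 <= B).
  { eapply Rle_trans; [apply Rabs_pos|apply (HB w)]. rewrite Rminus_diag, Rabs_R0. lra. }
  assert (Hq2 : Rabs (q x - q w - flat 1 d1 w * (x - w)) <= B * (x - w) ^ 2).
  { replace (q x - q w - flat 1 d1 w * (x - w))
      with ((q x - flat 1 d1 w * x) - (q w - flat 1 d1 w * w)) by ring.
    rewrite <- pow2_abs. simpl. rewrite Rmult_1_r, <- Rmult_assoc.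
    apply (bounded_variation (fun y => q y - flat 1 d1 w * y)
             (fun y => flat 1 d1 y - flat 1 d1 w)).
    intros u Hu. assert (Hu' : Rabs (u - w) <= w ^ 6) by lra. split.
    - apply (is_derive_minus (K := R_AbsRing) (V := R_NormedModule) q
               (fun y => flat 1 d1 w * y)); [now apply Hq|].
      auto_derive; [exact I|ring].
    - eapply Rle_trans; [now apply Hq1|]. now apply Rmult_le_compat_l. }
  assert (Hqw : q w = 0).
  { unfold q, flat. simpl. rewrite Hwi, Hsin. ring. }
  assert (Hdw : flat 1 d1 w = - (exp (- t) * t ^ 9 * cos t)).
  { unfold flat. rewrite He. unfold d1, slope_term. simpl.
    rewrite Hwi, Hsin. ring. }
  assert (Hcos : Rabs (cos t) = 1).
  { pose proof (sin2_cos2 t) as H. rewrite Hsin in H. unfold Rsqr in H.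
    rewrite Rmult_0_l, Rplus_0_l in H.
    rewrite <- sqrt_1, <- H. symmetry. apply sqrt_Rsqr_abs. }
  assert (Hpos : 0 < exp (- t) * t ^ 9)
    by (apply Rmult_lt_0_compat; [apply exp_pos|apply pow_lt; lra]).
  replace (exp (- t) * t ^ 9 * Rabs (x - w)) with (Rabs (flat 1 d1 w * (x - w))).
  2:{ rewrite Hdw, Rabs_mult, Rabs_Ropp, Rabs_mult, Hcos, Rabs_pos_eq by lra. ring. }
  eapply Rle_trans; [apply Rabs_triang_inv2|].
  change (flat 1 slope_term x) with (q x).
  rewrite Hqw, Rminus_0_r in Hq2. eapply Rle_trans; [exact Hq2|].
  assert (0 <= exp (- t) * t ^ 12 * (x - w) ^ 2).
  { apply Rmult_le_pos; [|apply pow2_ge_0].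
    apply Rmult_le_pos; [apply Rlt_le, exp_pos|apply pow_le; lra]. }
  unfold B. nra.
Qed.

(** The step [t^-7] balances the two errors: it exceeds the width [t^-9] of the
    rounding of the kink, so the slope [e^(-t) t^9] yields a height
    [e^(-t) t^2] per step, and over [J <= t] steps the quadratic error is
    [O(e^(-t) t^12 (t^-6)^2)], that is [O(e^(-t))]. *)
Lemma root_near_kink :
  exists K, 0 < K /\ forall (t : R) (J p k : nat),
    3 <= t -> INR J <= t -> sin t = 0 -> (S p <= J)%nat -> (k <= J)%nat ->
    let x := / t - INR (S p) * (/ t) ^ 7 + INR k * (/ t) ^ 7 in
    Rabs (x - / t) <= (/ t) ^ 6 /\
    Rabs (flat_ext 1 root_term x - exp (- t) * t ^ 2 * kink p k) <= K * exp (- t).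
Proof.
  destruct slope_almost_linear as [K [HK Hlin]].
  exists (3 + K). split; [lra|]. intros t J p k Ht HJ Hsin Hp Hk x.
  assert (Hw : 0 < / t) by (apply Rinv_0_lt_compat; lra).
  set (w := / t) in *.
  assert (Htw : t * w = 1) by (apply Rinv_r; lra).
  pose proof (pow_lt w 7 Hw) as Hw7.
  assert (Hxw : Rabs (x - w) = kink p k * w ^ 7).
  { unfold x, kink. rewrite <- (Rabs_pos_eq (w ^ 7)) at 3 by lra.
    rewrite <- Rabs_mult. f_equal. ring. }
  assert (Hkink : 0 <= kink p k <= t).
  { unfold kink. split; [apply Rabs_pos|]. apply le_INR in Hp, Hk.
    pose proof (pos_INR k). pose proof (pos_INR (S p)). apply Rabs_le. lra. }
  assert (Hclose : Rabs (x - w) <= w ^ 6).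
  { rewrite Hxw. replace (w ^ 6) with (t * w ^ 7);
      [apply Rmult_le_compat_r; lra|].
    replace (t * w ^ 7) with (t * w * w ^ 6) by ring. rewrite Htw. ring. }
  split; [exact Hclose|].
  destruct (close_point t x Ht Hclose) as (Hx1 & _ & Hx3 & _).
  pose proof (root_near_abs_slope x (proj1 Hx1)) as H1.
  pose proof (Hlin t x Ht Hsin Hclose) as H2. fold w in H2.
  assert (Hlead : exp (- t) * t ^ 9 * Rabs (x - w) = exp (- t) * t ^ 2 * kink p k).
  { rewrite Hxw.
    replace (exp (- t) * t ^ 9 * (kink p k * w ^ 7))
      with (exp (- t) * t ^ 2 * kink p k * (t * w) ^ 7) by ring.
    rewrite Htw. ring. }
  rewrite Hlead in H2.
  assert (Hquad : t ^ 12 * (x - w) ^ 2 <= 1).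
  { replace 1 with ((t * w) ^ 12) by (rewrite Htw; ring).
    rewrite Rpow_mult_distr. apply Rmult_le_compat_l; [apply pow_le; lra|].
    rewrite <- pow2_abs. replace (w ^ 12) with ((w ^ 6) ^ 2) by ring.
    apply pow_incr. split; [apply Rabs_pos|exact Hclose]. }
  pose proof (exp_pos (- t)) as Het.
  assert (K * (exp (- t) * t ^ 12 * (x - w) ^ 2) <= K * exp (- t)).
  { apply Rmult_le_compat_l; [lra|]. nra. }
  replace (flat_ext 1 root_term x - exp (- t) * t ^ 2 * kink p k)
    with ((flat_ext 1 root_term x - Rabs (flat 1 slope_term x)) +
          (Rabs (flat 1 slope_term x) - exp (- t) * t ^ 2 * kink p k)) by ring.
  eapply Rle_trans; [apply Rabs_triang|]. lra.
Qed.

Lemma fact_le_pow (n : nat) (y : R) : INR n <= y -> INR (fact n) <= y ^ n.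
Proof.
  induction n as [|n IH]; intros H; [simpl; lra|].
  change (fact (S n)) with (S n * fact n)%nat. rewrite mult_INR. cbn [pow].
  rewrite S_INR in *.
  pose proof (pos_INR n). pose proof (INR_fact_lt_0 n).
  assert (INR (fact n) <= y ^ n) by (apply IH; lra).
  apply Rmult_le_compat; lra.
Qed.

Lemma exp_mult_INR (n : nat) (x : R) : exp (INR n * x) = exp x ^ n.
Proof.
  induction n as [|n IH]; [simpl; rewrite Rmult_0_l; apply exp_0|].
  rewrite S_INR, Rmult_plus_distr_r, Rmult_1_l, exp_plus, IH. simpl. ring.
Qed.

(** The difference of order [J] at step [t^-7], with [t = J pi], is too large for
    the bounds that membership would give. *)
Lemma root_not_calE1 : ~ calE1 gevrey (flat_ext 1 root_term).
Proof.
  intros [_ [C [sigma [HC [Hsigma [eps Hloc]]]]]].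
  destruct root_near_kink as [K [HK Hkink]].
  destruct (INR_unbounded (2 * K + 3 + 2 / eps + sigma * exp PI * (C + 1)))
    as [n Hn].
  pose proof (cond_pos eps) as Heps.
  assert (Heps2 : 0 < 2 / eps) by (apply Rdiv_lt_0_compat; lra).
  assert (Hz0 : 0 < sigma * exp PI) by (apply Rmult_lt_0_compat; [easy|apply exp_pos]).
  assert (Hz1 : 0 < sigma * exp PI * (C + 1)) by (apply Rmult_lt_0_compat; lra).
  set (J := S (S n)). set (t := INR J * PI).
  assert (HPI : 3 < PI) by (pose proof PI2_3_2; lra).
  assert (HJn : INR J = INR n + 2) by (unfold J; rewrite !S_INR; ring).
  assert (HJt : 3 * INR J <= t) by (unfold t; pose proof (pos_INR J); nra).
  assert (Ht3 : 3 <= t) by lra.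
  assert (Hsin : sin t = 0).
  { apply sin_eq_0_1. exists (Z.of_nat J). unfold t. now rewrite INR_IZR_INZ. }
  assert (Hw : 0 < / t) by (apply Rinv_0_lt_compat; lra).
  pose proof (Rinv_r t ltac:(lra)) as Htw.
  destruct (exists_large_diff_kink n) as [p [Hp Hlarge]].
  fold J in Hlarge.
  set (w := / t) in *.
  set (x0 := w - INR (S p) * w ^ 7).
  set (u := fun k => flat_ext 1 root_term (x0 + INR k * w ^ 7)).
  pose proof (exp_pos (- t)) as Het.
  (* The main term is exp (- t) t^2 2^(n+1) / (n + 1), the error is at most
     exp (- t) K 2^(n+2), and n + 1 <= t. *)
  assert (Hlow : exp (- t) <= Rabs (diff J u 0)).
  { set (v := fun k => exp (- t) * t ^ 2 * kink p k).
    assert (Herr : Rabs (diff J (fun k => u k - v k) 0) <= 2 ^ J * (K * exp (- t))).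
    { apply diff_bound. intros k Hk.
      apply (Hkink t J p k); try assumption; unfold J in *; try lia; lra. }
    rewrite diff_minus in Herr. unfold v in Herr. rewrite diff_scal in Herr.
    set (D := diff J (kink p) 0) in *.
    assert (Htri : exp (- t) * t ^ 2 * Rabs D - 2 ^ J * (K * exp (- t)) <= Rabs (diff J u 0)).
    { rewrite <- (Rabs_pos_eq (exp (- t) * t ^ 2)), <- Rabs_mult by nra.
      rewrite Rabs_minus_sym in Herr.
      pose proof (Rabs_triang_inv (exp (- t) * t ^ 2 * D) (diff J u 0)). lra. }
    assert (Hpow : 1 <= 2 ^ n) by (apply pow_R1_Rle; lra).
    assert (HSn : INR (S n) <= t) by (rewrite S_INR; lra).
    assert (HSn0 : 0 < INR (S n)) by (apply lt_0_INR; lia).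
    replace (2 ^ J) with (4 * 2 ^ n) in Htri by (unfold J; simpl; ring).
    apply Rmult_le_reg_l with (INR (S n)); [exact HSn0|].
    apply Rle_trans with (exp (- t) * (2 ^ n * (2 * t ^ 2 - 4 * K * t))).
    - assert (1 <= 2 * t - 4 * K) by lra.
      assert (Hm : t <= 2 * t ^ 2 - 4 * K * t) by nra.
      assert (t <= 2 ^ n * (2 * t ^ 2 - 4 * K * t)) by nra.
      rewrite Rmult_comm. apply Rmult_le_compat_l; lra.
    - apply Rmult_le_compat_l with (r := INR (S n)) in Htri; [|lra].
      eapply Rle_trans; [|exact Htri].
      assert (Ha : 0 <= exp (- t) * t ^ 2) by nra.
      apply Rmult_le_compat_l with (r := exp (- t) * t ^ 2) in Hlarge; [|exact Ha].
      assert (Hb : 0 <= 4 * 2 ^ n * (K * exp (- t))).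
      { repeat apply Rmult_le_pos; lra. }
      apply Rmult_le_compat_l with (r := 4 * 2 ^ n * (K * exp (- t))) in HSn; [|exact Hb].
      lra. }
  assert (Hup : Rabs (diff J u 0) <=
            (w ^ 7) ^ J * (C * sigma ^ J * INR (fact J) * gevrey J)).
  { apply (diff_le_derivative
             (fun k => flat_ext 1 (dflat_n 1 k root_term)) (w ^ 7) _ J 0 x0).
    - now apply pow_lt.
    - intros k y. apply (is_derive_flat_ext 1 (dflat_n 1 k root_term)). lra.
    - intros y Hy. rewrite Nat.add_0_l, <- Derive_n_flat_ext by lra.
      apply Hloc.
      assert (HpJ : (S p <= J)%nat) by (unfold J; lia).
      destruct (Hkink t J p 0%nat Ht3 ltac:(lra) Hsin HpJ ltac:(lia)) as [Ha _].
      destruct (Hkink t J p J Ht3 ltac:(lra) Hsin HpJ ltac:(lia)) as [Hb _].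
      fold w x0 in Ha, Hb. simpl INR in Ha. rewrite Rmult_0_l, Rplus_0_r in Ha.
      assert (Hyw : Rabs (y - w) <= w ^ 6).
      { apply Rabs_le_between in Ha, Hb. apply Rabs_le. lra. }
      destruct (close_point t y Ht3 Hyw) as (Hy1 & _ & _ & Hy2). fold w in Hy2.
      unfold ball; simpl. unfold AbsRing_ball, abs, minus, plus, opp; simpl.
      rewrite Ropp_0, Rplus_0_r, Rabs_pos_eq by lra.
      apply Rle_lt_trans with (2 * w); [exact Hy2|].
      apply Rmult_lt_reg_r with (t / eps); [apply Rdiv_lt_0_compat; lra|].
      replace (2 * w * (t / eps)) with (2 / eps * (t * w)) by (field; lra).
      rewrite Htw. replace (eps * (t / eps)) with t by (field; lra). lra. }
  (* The upper bound is C z^J exp (- t), and t >= sigma exp PI (C + 1) makes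
     C z^J smaller than 1. *)
  set (z := sigma * exp PI * w ^ 3).
  assert (Hz : 0 < z <= / (C + 1)).
  { assert (Hw1 : w <= 1) by nra.
    assert (Hw3 : 0 < w ^ 3 <= w) by (split; [now apply pow_lt|simpl; nra]).
    split; [unfold z; nra|].
    apply Rmult_le_reg_r with (C + 1); [lra|]. rewrite Rinv_l by lra.
    unfold z. nra. }
  assert (Hupper : (w ^ 7) ^ J * (C * sigma ^ J * INR (fact J) * gevrey J)
            <= C * z ^ J * exp (- t)).
  { assert (Hf1 : INR (fact J) <= t ^ J) by (apply fact_le_pow; lra).
    assert (Hf2 : gevrey J <= (t ^ 3) ^ J).
    { rewrite <- pow_mult. apply fact_le_pow. rewrite mult_INR. simpl (INR 3). lra. }
    assert (Hexp : exp (- t) * exp PI ^ J = 1).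
    { unfold t. rewrite <- exp_mult_INR, <- exp_plus, Rplus_opp_l. apply exp_0. }
    pose proof (gevrey_pos J). pose proof (INR_fact_lt_0 J).
    assert (Hff : INR (fact J) * gevrey J <= t ^ J * (t ^ 3) ^ J)
      by (apply Rmult_le_compat; lra).
    apply Rle_trans with ((w ^ 7) ^ J * (C * sigma ^ J) * (t ^ J * (t ^ 3) ^ J)).
    - replace ((w ^ 7) ^ J * (C * sigma ^ J * INR (fact J) * gevrey J))
        with ((w ^ 7) ^ J * (C * sigma ^ J) * (INR (fact J) * gevrey J)) by ring.
      apply Rmult_le_compat_l; [|exact Hff].
      apply Rmult_le_pos; [apply pow_le, pow_le; lra|].
      apply Rmult_le_pos; [lra|apply pow_le; lra].
    - right. unfold z. rewrite !Rpow_mult_distr.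
      replace (C * (sigma ^ J * exp PI ^ J * (w ^ 3) ^ J) * exp (- t))
        with (C * sigma ^ J * (w ^ 3) ^ J * (exp (- t) * exp PI ^ J)) by ring.
      rewrite Hexp, Rmult_1_r.
      replace ((w ^ 7) ^ J * (C * sigma ^ J) * (t ^ J * (t ^ 3) ^ J))
        with (C * sigma ^ J * ((w ^ 7) ^ J * (t ^ J * (t ^ 3) ^ J))) by ring.
      f_equal. rewrite <- !Rpow_mult_distr. f_equal.
      replace (w ^ 7 * (t * t ^ 3)) with (w ^ 3 * (t * w) ^ 4) by ring.
      rewrite Htw. ring. }
  assert (Hzj : C * z ^ J < 1).
  { assert (Hinv : / (C + 1) <= 1).
    { rewrite <- Rinv_1. apply Rinv_le_contravar; lra. }
    assert (Hzp : z ^ J <= z).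
    { unfold J. cbn [pow]. apply Rle_trans with (z * 1); [|lra].
      apply Rmult_le_compat_l; [lra|]. change (z * z ^ n) with (z ^ S n).
      rewrite <- (pow1 (S n)). apply pow_incr. lra. }
    apply Rle_lt_trans with (C * / (C + 1)).
    - apply Rmult_le_compat_l; lra.
    - apply Rmult_lt_reg_r with (C + 1); [lra|].
      rewrite Rmult_assoc, Rinv_l by lra. lra. }
  nra.
Qed.

(** * Conclusion *)

Lemma calE1_const (c : R) : calE1 gevrey (fun _ => c).
Proof.
  split.
  - unfold smooth_germ. apply filter_forall. intros x n. apply ex_derive_n_const.
  - exists (Rabs c + 1), 1. pose proof (Rabs_pos c). repeat split; try lra.
    apply filter_forall. intros x j. rewrite pow1.
    pose proof (gevrey_pos j). pose proof (INR_fact_lt_0 j).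
    destruct j as [|j].
    + unfold gevrey. simpl. lra.
    + rewrite Derive_n_const, Rabs_R0. repeat apply Rmult_le_pos; lra.
Qed.

Lemma calE1_opp (M : nat -> R) (f : R -> R) :
  calE1 M f -> calE1 M (fun x => - f x).
Proof.
  intros [Hf [C [s [HC [Hs Hb]]]]]. split.
  - unfold smooth_germ in *. generalize Hf. apply filter_imp.
    intros x Hx n. now apply ex_derive_n_opp.
  - exists C, s. repeat split; try assumption.
    generalize Hb. apply filter_imp. intros x Hx j.
    rewrite Derive_n_opp, Rabs_Ropp. apply Hx.
Qed.

Lemma gevrey_not_quasianalytic : ~ quasianalytic (calE1 gevrey).
Proof.
  intros H.
  assert (Hw : trigonometric weight_term) by (simpl; tauto).
  destruct (H (flat_ext 2 weight_term) (calE1_flat_ext _ Hw)) as [d Hd].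
  - intros j. rewrite Derive_n_flat_ext by lra. apply flat_ext_nonpos. lra.
  - pose proof (cond_pos d) as Hdp.
    assert (Hball : ball 0 d (d / 2)).
    { unfold ball; simpl. unfold AbsRing_ball, abs, minus, plus, opp; simpl.
      rewrite Ropp_0, Rplus_0_r, Rabs_pos_eq by lra. lra. }
    specialize (Hd _ Hball). rewrite flat_ext_pos in Hd by lra.
    unfold flat in Hd. change (eval weight_term (d / 2)) with (weight (d / 2)) in Hd.
    pose proof (weight_ge_1 (d / 2)). pose proof (exp_pos (- (2) / (d / 2))). nra.
Qed.

Theorem mainTheorem3 :
  exists M : nat -> R,
    Un_growing M /\ M 0%nat = 1 /\ log_convex M /\
    stable_under_derivation (calE1 M) /\ ~ quasianalytic (calE1 M) /\
    exists g : R -> R,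
      calE1 M g /\ nonneg_germ g /\
      let h : R -> R := fun x => sqrt (g x) in
      let phi : R -> R -> R := fun x y => y ^ 2 - g x in
      smooth_germ h /\ ~ calE1 M h /\
      monic_polynomial_over (calE1 M) phi /\
      locally 0 (fun x => phi x (h x) = 0).
Proof.
  exists gevrey.
  split; [exact gevrey_growing|]. split; [reflexivity|].
  split; [exact gevrey_log_convex|]. split; [exact gevrey_stable|].
  split; [exact gevrey_not_quasianalytic|].
  assert (Hg : calE1 gevrey (flat_ext 2 weight_term)).
  { apply calE1_flat_ext. simpl. tauto. }
  assert (Hroot : germ_eq (flat_ext 1 root_term)
                          (fun x => sqrt (flat_ext 2 weight_term x))).
  { unfold germ_eq. apply filter_forall. intros x. symmetry. apply sqrt_flat_ext_weight. }
  exists (flat_ext 2 weight_term).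
  split; [exact Hg|].
  split; [unfold nonneg_germ; apply filter_forall, flat_ext_weight_nonneg|].
  intros h phi. repeat split.
  - apply (smooth_germ_ext _ _ Hroot). unfold smooth_germ.
    apply filter_forall. intros x n. apply smooth_flat_ext. lra.
  - intros Hh. apply root_not_calE1. revert Hh. apply calE1_ext.
    unfold germ_eq in *. generalize Hroot. apply filter_imp. intros x Hx. now symmetry.
  - exists 2%nat, (fun k x => match k with
                              | 0%nat => - flat_ext 2 weight_term x
                              | 1%nat => 0
                              | _ => 1
                              end).
    split; [|split].
    + intros [|[|k]] _; [now apply calE1_opp|apply calE1_const|apply calE1_const].
    + unfold germ_eq. now apply filter_forall.
    + apply filter_forall. intros x y. unfold phi. simpl. ring.
  - apply filter_forall. intros x. unfold phi, h.
    rewrite pow2_sqrt by apply flat_ext_weight_nonneg. ring.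
Qed.
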